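(* Let $p\le q$ be positive integers, $f=x^p+y^q\in\mathbb C[x,y]$ and $\ell\in\mathbb Z_{<0}$. Then for every $\omega=(\omega_1,\omega_2)\in\mathbb R^2\setminus\{0\}$, $$b_{\mathrm{Ann}(f^\ell),\omega}(s)=\begin{cases}(s-\ell q\omega_2)\displaystyle\prod_{i=1}^{q-1}\Big(s-\big(\ell p+\tfrac pq i\big)\omega_1+i\omega_2\Big)&\text{if }p\omega_1>q\omega_2,\\[2mm] (s-\ell p\omega_1)\displaystyle\prod_{i=1}^{p-1}\Big(s+i\omega_1-\big(\ell q+\tfrac qp i\big)\omega_2\Big)&\text{if }p\omega_1<q\omega_2,\\[2mm] s-\ell p\omega_1&\text{if }p\omega_1=q\omega_2.\end{cases}$$ In particular these b-functions have no multiple roots.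
   Context: $D_2$ is the second Weyl algebra in $x,y,\partial_x,\partial_y$; ideals are left ideals. For $\omega\in\mathbb R^2$, the $(-\omega,\omega)$-weight of $x^{a}y^{b}\partial_x^{c}\partial_y^{e}$ is $-\omega_1a-\omega_2b+\omega_1c+\omega_2e$; $\mathrm{in}_{(-\omega,\omega)}(I)$ is the left ideal generated by the maximal-weight parts of the (normally ordered) elements of $I$. For a holonomic ideal $I$ and $\omega\neq0$, with $s=\omega_1x\partial_x+\omega_2y\partial_y$, the b-function $b_{I,\omega}(s)$ is the monic generator of $\mathrm{in}_{(-\omega,\omega)}(I)\cap\mathbb C[s]$. $\mathrm{Ann}(f^\ell)=\{P\in D_2:P\bullet f^\ell=0\}$ with $x\bullet g=xg$, $\partial_x\bullet g=\partial g/\partial x$, etc. *)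

(* Defs.v *)
From mathcomp Require Import all_boot all_algebra all_field.
From mathcomp Require Import reals complex.
From mathcomp Require Import mpoly.
Set Implicit Arguments. Unset Strict Implicit. Unset Printing Implicit Defensive.
Import GRing.Theory Num.Theory.
Local Open Scope ring_scope.

Section Weyl.
Variable R : realType.
Local Notation C := (R[i]).

Definition vx2 : 'I_2 := @Ordinal 2 0 isT.
Definition vy2 : 'I_2 := @Ordinal 2 1 isT.

(* Elements of the Weyl algebra D_2 are represented by their normally ordered
   form  sum c_m x^m0 y^m1 dx^m2 dy^m3, i.e. by a commutative polynomial in
   four variables: index 0 = x, 1 = y, 2 = dx, 3 = dy. *)
Definition D2 := {mpoly C[4]}.
Definition iX  : 'I_4 := @Ordinal 4 0 isT.
Definition iY  : 'I_4 := @Ordinal 4 1 isT.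
Definition iDX : 'I_4 := @Ordinal 4 2 isT.
Definition iDY : 'I_4 := @Ordinal 4 3 isT.

Definition nmono (a b c e : nat) : D2 :=
  'X_iX ^+ a * 'X_iY ^+ b * 'X_iDX ^+ c * 'X_iDY ^+ e.

(* Product of normally ordered monomials in D_2 (Leibniz rule):
   dx^c x^a' = sum_k C(c,k) a'(a'-1)...(a'-k+1) x^(a'-k) dx^(c-k). *)
Definition mono_mul (m m' : 'X_{1..4}) : D2 :=
  \sum_(k < (m iDX).+1) \sum_(j < (m iDY).+1)
     (('C(m iDX, k) * (m' iX) ^_ k * 'C(m iDY, j) * (m' iY) ^_ j)%N%:R) *:
       nmono (m iX + m' iX - k) (m iY + m' iY - j)
             (m iDX + m' iDX - k) (m iDY + m' iDY - j).

Definition weyl_mul (P Q : D2) : D2 :=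
  \sum_(m <- msupp P) \sum_(m' <- msupp Q) (P@_m * Q@_m') *: mono_mul m m'.

Definition weyl_pow (P : D2) (k : nat) : D2 := iter k (weyl_mul P) 1.

(* a pair (g, n) represents the function g / f^n *)
Definition dfrac (f : {mpoly C[2]}) (i : 'I_2) (gn : {mpoly C[2]} * nat)
  : {mpoly C[2]} * nat :=
  (gn.1^`M(i) * f - (gn.2)%:R *: (gn.1 * f^`M(i)), gn.2.+1).

Definition fpow (f : {mpoly C[2]}) (l : int) : {mpoly C[2]} * nat :=
  match l with
  | Posz n => (f ^+ n, 0%N)
  | Negz n => (1, n.+1)
  end.

Definition mono_act (f : {mpoly C[2]}) (m : 'X_{1..4})
  (gn : {mpoly C[2]} * nat) : {mpoly C[2]} * nat :=
  let hn := iter (m iDY) (dfrac f vy2) (iter (m iDX) (dfrac f vx2) gn) in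
  ('X_vx2 ^+ (m iX) * 'X_vy2 ^+ (m iY) * hn.1, hn.2).

(* P . f^l = 0, computed over the common denominator f^(n0 + N) where
   N = msize P bounds every differentiation order. *)
Definition annihilates (f : {mpoly C[2]}) (l : int) (P : D2) : Prop :=
  \sum_(m <- msupp P)
     P@_m *: ((mono_act f m (fpow f l)).1 *
              f ^+ (msize P + (fpow f l).2 - (mono_act f m (fpow f l)).2))
  = 0.

Definition Ann (f : {mpoly C[2]}) (l : int) : D2 -> Prop := annihilates f l.

Definition wt (w : R * R) (m : 'X_{1..4}) : R :=
  - w.1 * (m iX)%:R - w.2 * (m iY)%:R + w.1 * (m iDX)%:R + w.2 * (m iDY)%:R.

Definition in_w (w : R * R) (P : D2) : D2 :=
  \sum_(m <- msupp P | all (fun m' => wt w m' <= wt w m) (msupp P))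
     P@_m *: 'X_[m].

Definition in_ideal (I : D2 -> Prop) (w : R * R) (Q : D2) : Prop :=
  exists s : seq (D2 * D2),
    (forall qp, qp \in s -> I qp.2) /\
    Q = \sum_(qp <- s) weyl_mul qp.1 (in_w w qp.2).

Definition sop (w : R * R) : D2 :=
  (real_complex R w.1) *: ('X_iX * 'X_iDX) + (real_complex R w.2) *: ('X_iY * 'X_iDY).

Definition eval_s (w : R * R) (c : {poly C}) : D2 :=
  \sum_(k < size c) c`_k *: weyl_pow (sop w) k.

Definition is_bfunction (I : D2 -> Prop) (w : R * R) (b : {poly C}) : Prop :=
  b \is monic /\ forall c : {poly C}, in_ideal I w (eval_s w c) <-> (b %| c)%R.

End Weyl.

(* Main.v *)
From HB Require Import structures.
Require Import Defs.
From mathcomp Require Import all_boot all_order all_algebra all_field.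
From mathcomp Require Import reals complex.
From mathcomp Require Import ssrcomplements mpoly.
From mathcomp Require Import boolp ring zify.
Import Order.TTheory GRing.Theory Num.Theory.
Local Open Scope ring_scope.

(** Let a function phi : C -> C -> C stand for the formal sum of
    phi(a,b) x^a y^b over all complex exponents; these sums form a faithful
    module over D_2, in which theta_x, theta_y act diagonally by a and b.

    Put f = x^p + y^q and l = -n. For every lam the bilateral expansion
      u = sum_(k in Z) (-1)^k C(lam + k + n - 1, n - 1)
                       x^(p (lam + k)) y^(-q (lam + k + n)),
    whose coefficients are polynomial in lam + k, is the n-th member of a
    sequence u_n with f u_(n+1) = u_n, dx u_n = - n f_x u_(n+1) and
    dy u_n = - n f_y u_(n+1). So g / f^n |-> g u_n is D_2-linear and Ann(f^l)
    kills u, whatever lam is. If p w1 > q w2, work modulo the series without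
    negative integral powers of y: for lam = i / q - n with 0 < i < q or
    i = q n, what remains of u starts, in order of increasing weight, with
    the single term of exponents (p lam, -i). It is killed by the initial
    ideal, so its weight is a root of every b(s) in that ideal; these weights
    are the announced roots. The case p w1 < q w2 is the same with x and y
    exchanged, and if p w1 = q w2 one takes lam = 0 and all of u.

    Conversely x dx / p + y dy / q - l and q y^(q-1) dx - p x^(p-1) dy lie in
    Ann(f^l), and multiplying the initial form of the latter by dy^(q-1) and x
    gives theta_x (theta_y + 1) ... (theta_y + q - 1), which is the b-function
    up to a scalar modulo the former. *)

(** * The Weyl algebra acting on formal sums *)

Section LinearExtension.
Context {n : nat} {K : comNzRingType} {V : lmodType K}.
Implicit Type (F : 'X_{1..n} -> V) (P Q : {mpoly K[n]}).

(** Summing over [msupp P] makes the sums in [annihilates] and the action below instances by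
    conversion. *)
Definition mext F P : V := \sum_(m <- msupp P) P@_m *: F m.

(** P, Q and [c *: P + Q] have different supports; a common size bound lets linearity be checked
    term by term. *)
Lemma mext_bounded F P k : (msize P <= k)%N ->
  mext F P = \sum_(m : 'X_{1..n < k}) P@_m *: F m.
Proof.
move=> le_Pk; rewrite /mext (big_mksub 'X_{1..n < k}) /=.
- by rewrite big_rmcond //= => m /memN_msupp_eq0 ->; rewrite scale0r.
- exact: msupp_uniq.
- by move=> m /msize_mdeg_lt /leq_trans; apply.
Qed.

Lemma mext_is_linear F : linear (mext F).
Proof.
move=> c P Q; pose k := maxn (maxn (msize P) (msize Q)) (msize (c *: P + Q)).
rewrite !(@mext_bounded F _ k) ?leq_max ?leqnn ?orbT //.
rewrite scaler_sumr -big_split /=; apply: eq_bigr => m _.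
by rewrite mcoeffD mcoeffZ scalerDl scalerA.
Qed.
HB.instance Definition _ F :=
  GRing.isLinear.Build K {mpoly K[n]} V _ (mext F) (mext_is_linear F).

Lemma mextX F m : mext F 'X_[m] = F m.
Proof. by rewrite /mext msuppX big_seq1 mcoeffX eqxx scale1r. Qed.
End LinearExtension.

(** * Rising factorials and the action of normally ordered monomials *)

Section FormalSums.
Context {R : realType}.
Local Notation C := (R[i]).
Implicit Types (P Q : D2 R) (phi : C -> C -> C) (a b u : C) (m : 'X_{1..4}).

(** The factor in dx^c x^(u+c) = [rfact u c] x^u, for any complex u. *)
Definition rfact u c : C := \prod_(t < c) (u + t.+1%:R).

Lemma rfact0 u : rfact u 0 = 1.
Proof. by rewrite /rfact big_ord0. Qed.

Lemma rfactS u c : rfact u c.+1 = (u + 1) * rfact (u + 1) c.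
Proof.
rewrite /rfact big_ord_recl /=; congr (_ * _); apply: eq_bigr => t _.
by rewrite -addrA -natr1 [1 + _]addrC natr1.
Qed.

Lemma rfactSr u c : rfact u c.+1 = rfact u c * (u + c.+1%:R).
Proof. by rewrite /rfact big_ord_recr. Qed.

Lemma rfactD u c d : rfact u (c + d) = rfact u c * rfact (u + c%:R) d.
Proof.
rewrite /rfact big_split_ord /=; congr (_ * _); apply: eq_bigr => t _.
by rewrite -addnS natrD addrA.
Qed.

Lemma rfact_eq0P u c :
  reflect (exists2 t : nat, (t < c)%N & u + t.+1%:R = 0) (rfact u c == 0).
Proof.
apply: (iffP idP) => [/prodf_eq0[t _ /eqP ut] | [t tc ut]].
  by exists t.
by apply/prodf_eq0; exists (Ordinal tc); rewrite //= ut.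
Qed.

(** The difference is taken in C, without truncation; for k > d both sides vanish. *)
Lemma natr_ffactSr d k :
  (d ^_ k.+1)%:R = (d ^_ k)%:R * (d%:R - k%:R) :> C.
Proof.
rewrite ffactnSr natrM; case: (leqP k d) => [kd | dk]; first by rewrite natrB.
by rewrite (ffact_small dk) !mul0r.
Qed.

(* Chu-Vandermonde; [rfact (u + d) c] is the coefficient of
   dx^c x^d on x^(u + c), the right side its normal ordering. *)
Lemma rfact_shift u d c :
  rfact (u + d%:R) c =
  \sum_(k < c.+1) ('C(c, k) * d ^_ k)%N%:R * rfact (u + k%:R) (c - k).
Proof.
elim: c u => [|c IH] u.
  by rewrite big_ord_recl big_ord0 subn0 !rfact0 bin0 ffactn0 mulr1 addr0.
rewrite rfactS -addrA [_ + 1]addrC addrA {}IH.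
(* Pascal's rule gives the sum of C(c, k) (G k + G (k+1)), and each bracket contains the factor u +
   1 + d. *)
pose G k := (d ^_ k)%:R * rfact (u + k%:R) (c.+1 - k) : C.
have -> : \sum_(k < c.+2) ('C(c.+1, k) * d ^_ k)%N%:R
            * rfact (u + k%:R) (c.+1 - k)
        = \sum_(k < c.+1) 'C(c, k)%:R * (G k + G k.+1).
  rewrite big_ord_recl /= bin0.
  under eq_bigr => k _.
    rewrite /bump /= add1n binS natrM natrD -mulrA -/(G k.+1) mulrDl; over.
  under [RHS]eq_bigr => k _ do rewrite mulrDr.
  rewrite !big_split /= addrA; congr (_ + _).
  rewrite [RHS]big_ord_recl /= bin0 mul1n mul1r /G; congr (_ + _).
    by rewrite ffactn0 !mul1r.
  rewrite big_ord_recr /= bin_small // mul0r addr0.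
  by apply: eq_bigr.
rewrite big_distrr /=; apply: eq_bigr => k _.
have kc : (k <= c)%N by rewrite -ltnS.
rewrite /G subSn // rfactS natr_ffactSr subSS -!natr1 natrM.
have -> : u + (k%:R + 1) = u + 1 + k%:R by ring.
have -> : u + k%:R + 1 = u + 1 + k%:R by ring.
ring.
Qed.

(** The coefficient at x^a y^b of the image: [phi] is read at the exponents that the monomial sends
    to (a, b). *)
Definition mact m phi a b : C :=
  rfact (a - (m iX)%:R) (m iDX) * rfact (b - (m iY)%:R) (m iDY) *
  phi (a - (m iX)%:R + (m iDX)%:R) (b - (m iY)%:R + (m iDY)%:R).

Definition act P phi a b : C := mext (fun m => mact m phi a b : C^o) P.

Lemma actE P phi a b :
  act P phi a b = \sum_(m <- msupp P) P@_m * mact m phi a b.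
Proof. by []. Qed.

Lemma actX m phi a b : act 'X_[m] phi a b = mact m phi a b.
Proof. exact: mextX. Qed.

Lemma actD P Q phi a b : act (P + Q) phi a b = act P phi a b + act Q phi a b.
Proof. exact: linearD. Qed.

Lemma actB P Q phi a b : act (P - Q) phi a b = act P phi a b - act Q phi a b.
Proof. exact: linearB. Qed.

Lemma actZ c P phi a b : act (c *: P) phi a b = c * act P phi a b.
Proof. exact: linearZ. Qed.

Lemma act_sum I (r : seq I) (p : pred I) (F : I -> D2 R) phi a b :
  act (\sum_(i <- r | p i) F i) phi a b = \sum_(i <- r | p i) act (F i) phi a b.
Proof. exact: linear_sum. Qed.

Definition mono4 (x y dx dy : nat) : 'X_{1..4} :=
  [multinom [tuple x; y; dx; dy]].

Lemma mono4X x y dx dy : mono4 x y dx dy iX = x.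
Proof. by []. Qed.
Lemma mono4Y x y dx dy : mono4 x y dx dy iY = y.
Proof. by []. Qed.
Lemma mono4DX x y dx dy : mono4 x y dx dy iDX = dx.
Proof. by []. Qed.
Lemma mono4DY x y dx dy : mono4 x y dx dy iDY = dy.
Proof. by []. Qed.
Definition mono4E := (mono4X, mono4Y, mono4DX, mono4DY).

Lemma mnm4P m m' :
  m iX = m' iX -> m iY = m' iY -> m iDX = m' iDX -> m iDY = m' iDY -> m = m'.
Proof.
move=> eX eY eDX eDY; apply/mnmP; case=> [[|[|[|[|//]]]] lt].
- by rewrite (val_inj (erefl : val (Ordinal lt) = val iX)).
- by rewrite (val_inj (erefl : val (Ordinal lt) = val iY)).
- by rewrite (val_inj (erefl : val (Ordinal lt) = val iDX)).
- by rewrite (val_inj (erefl : val (Ordinal lt) = val iDY)).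
Qed.

Lemma nmonoE x y dx dy : nmono R x y dx dy = 'X_[mono4 x y dx dy].
Proof.
rewrite /nmono !mpolyXn -!mpolyXD; congr 'X_[_]; apply: mnm4P;
by rewrite !mnmDE !mulmnE !mnm1E /= !mono4E !(mul0n, mul1n, addn0, add0n).
Qed.

End FormalSums.

(** * The action is a faithful representation of the Weyl algebra *)

Section ActionOfWeylAlgebra.
Context {R : realType}.
Local Notation C := (R[i]).
Implicit Types (P Q : D2 R) (phi : C -> C -> C) (a b u : C) (m : 'X_{1..4}).

(** The product (x^a1 dx^c1)(x^a2 dx^c2) in one variable: normal ordering first gives the same
    coefficient as acting twice. *)
Lemma rfact_normal_order (g : C -> C) a (a1 a2 c1 c2 : nat) :
  \sum_(k < c1.+1) ('C(c1, k) * a2 ^_ k)%N%:R *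
     (rfact (a - (a1 + a2 - k)%N%:R) (c1 + c2 - k) *
      g (a - (a1 + a2 - k)%N%:R + (c1 + c2 - k)%N%:R)) =
  rfact (a - a1%:R) c1 * (rfact (a - a1%:R + c1%:R - a2%:R) c2 *
      g (a - a1%:R + c1%:R - a2%:R + c2%:R)).
Proof.
set u := a - a1%:R - a2%:R.
have -> : a - a1%:R = u + a2%:R by rewrite /u subrK.
have -> : u + a2%:R + c1%:R - a2%:R = u + c1%:R by ring.
rewrite rfact_shift big_distrl /=; apply: eq_bigr => k _.
have kc : (k <= c1)%N by rewrite -ltnS.
(* For k > a2 the exponent a1 + a2 - k may be truncated, but the falling factorial is then zero. *)
case: (leqP k a2) => [ka | ak]; last by rewrite (ffact_small ak) muln0 !mul0r.
have -> : a - (a1 + a2 - k)%N%:R = u + k%:R.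
  by rewrite natrB ?natrD ?/u; [ring | rewrite (leq_trans ka) ?leq_addl].
have -> : (c1 + c2 - k = c1 - k + c2)%N by rewrite addnBAC.
have e : u + k%:R + (c1 - k)%N%:R = u + c1%:R by rewrite natrB //; ring.
by rewrite rfactD natrD addrA e -!mulrA.
Qed.

Lemma act_mono_mul m m' phi a b :
  act (mono_mul R m m') phi a b = mact m (mact m' phi) a b.
Proof.
have E (x y z t w : C) : x * y * (z * t * w) = x * (z * (y * (t * w))) by ring.
rewrite /mono_mul act_sum.
under eq_bigr => k _.
  rewrite act_sum.
  under eq_bigr => j _.
    rewrite actZ nmonoE actX /mact !mono4E -mulnA natrM E; over.
  rewrite -mulr_sumr -mulr_sumr.
  rewrite (rfact_normal_order (fun y => phi _ y)); over.
rewrite (rfact_normal_order (fun x => rfact (b - (m iY)%:R) (m iDY) *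
    (rfact (b - (m iY)%:R + (m iDY)%:R - (m' iY)%:R) (m' iDY) *
      phi x (b - (m iY)%:R + (m iDY)%:R - (m' iY)%:R + (m' iDY)%:R)))).
rewrite /mact; ring.
Qed.

Lemma mact_sum I (r : seq I) m (c : I -> C) (F : I -> C -> C -> C) a b :
  mact m (fun x y => \sum_(i <- r) c i * F i x y) a b =
  \sum_(i <- r) c i * mact m (F i) a b.
Proof.
by rewrite /mact big_distrr /=; apply: eq_bigr => i _; rewrite mulrCA.
Qed.

Lemma act_mul P Q phi : act (weyl_mul P Q) phi = act P (act Q phi).
Proof.
apply: funext => a; apply: funext => b.
rewrite /weyl_mul act_sum [RHS]actE; apply: eq_bigr => m _.
rewrite act_sum [X in _ * X]mact_sum big_distrr /=; apply: eq_bigr => m' _.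
by rewrite actZ act_mono_mul -mulrA.
Qed.

Lemma rfact_sub_lt (i c : nat) : (i < c)%N -> rfact (i%:R - c%:R : C) c = 0.
Proof.
move=> ic; apply/eqP/rfact_eq0P; exists (c - i.+1)%N; first by lia.
have -> : (c - i.+1).+1%:R = c%:R - i%:R :> C
  by rewrite -natrB ?(ltnW ic) //; congr _%:R; lia.
ring.
Qed.

Lemma rfact_0_neq0 (i : nat) : rfact (0 : C) i != 0.
Proof.
apply/negP => /rfact_eq0P[t _]; rewrite add0r => /eqP.
by rewrite pnatr_eq0.
Qed.

(** Induction on the order: once the terms of lower order vanish, the coefficient at x^i y^j of P
    applied to x^c y^e isolates that of x^i y^j dx^c dy^e in P. *)
Lemma act_inj0 P : (forall phi a b, act P phi a b = 0) -> P = 0.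
Proof.
move=> P0; suff H d : forall m, (m iDX + m iDY < d)%N -> P@_m = 0.
  by apply/mpolyP => m; rewrite mcoeff0 (H (m iDX + m iDY).+1).
elim: d => // d IH m md.
pose delta (x y : C) : C := ((x == (m iDX)%:R) && (y == (m iDY)%:R))%:R.
have /eqP := P0 delta (m iX)%:R (m iY)%:R; rewrite actE.
case: (boolP (m \in msupp P)) => [mP | /memN_msupp_eq0 //].
rewrite (bigD1_seq m) ?msupp_uniq //= [X in _ + X]big1 ?addr0 => [|m' m'm].
  rewrite mulf_eq0 => /orP[/eqP // | ].
  rewrite /mact /delta !subrr !add0r !eqxx mulr1 mulf_eq0.
  by rewrite !(negPf (rfact_0_neq0 _)).
case: (ltnP (m' iDX + m' iDY) d) => [/IH -> |]; first by rewrite mul0r.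
move=> dm'; rewrite /mact /delta.
case: eqP => [ex | _]; last by rewrite !mulr0.
case: eqP => [ey | _]; last by rewrite !mulr0.
rewrite mulr1.
have -> : (m iX)%:R - (m' iX)%:R = (m iDX)%:R - (m' iDX)%:R :> C by rewrite -ex addrK.
have -> : (m iY)%:R - (m' iY)%:R = (m iDY)%:R - (m' iDY)%:R :> C by rewrite -ey addrK.
case: (ltnP (m iDX) (m' iDX)) => [/rfact_sub_lt ->|lex]; first by rewrite mul0r mulr0.
case: (ltnP (m iDY) (m' iDY)) => [/rfact_sub_lt ->|ley]; first by rewrite !mulr0.
case/eqP: m'm; have eDX : m' iDX = m iDX by lia.
have eDY : m' iDY = m iDY by lia.
move: ex ey; rewrite eDX eDY => /(canRL (addrK _)); rewrite subrr => /subr0_eq ex.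
move=> /(canRL (addrK _)); rewrite subrr => /subr0_eq ey.
by apply: mnm4P => //; apply/eqP; rewrite -(eqr_nat C) ?ex ?ey.
Qed.

(** Identities of [weyl_mul], such as associativity, can now be checked on the action. *)
Lemma act_inj P Q : (forall phi, act P phi = act Q phi) -> P = Q.
Proof.
move=> PQ; apply/subr0_eq/act_inj0 => phi a b.
by rewrite actB PQ subrr.
Qed.

End ActionOfWeylAlgebra.

(** * Initial forms and roots *)

Section InitialForms.
Context {R : realType}.
Local Notation C := (R[i]).
Implicit Types (P Q : D2 R) (phi : C -> C -> C) (a b u r : C) (m : 'X_{1..4}).
Implicit Types (w : R * R) (N : C -> C -> Prop).

Definition weight w a b : C := real_complex R w.1 * a + real_complex R w.2 * b.

(** An operator monomial lowers the weight of exponents by its own weight, so top-weight operators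
    pair with lowest-weight terms of a formal sum. *)
Lemma wtE w m a b : real_complex R (wt w m) =
  weight w (a - (m iX)%:R + (m iDX)%:R) (b - (m iY)%:R + (m iDY)%:R) -
  weight w a b.
Proof. by rewrite /wt /weight !(rmorphD, rmorphN, rmorphM, rmorph_nat) /=; ring. Qed.

Lemma act_1 phi : act 1 phi = phi.
Proof.
apply: funext => a; apply: funext => b.
by rewrite -mpolyX0 actX /mact !mnm0E !rfact0 !subr0 !addr0 !mul1r.
Qed.

Lemma act_theta_x phi a b : act ('X_iX * 'X_iDX) phi a b = a * phi a b.
Proof.
have -> : 'X_iX * 'X_iDX = 'X_[mono4 1 0 1 0] :> D2 R.
  by rewrite -nmonoE /nmono !expr1 !expr0 !mulr1.
by rewrite actX /mact !mono4E rfactS !rfact0 subr0 addr0 subrK !mulr1.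
Qed.

Lemma act_theta_y phi a b : act ('X_iY * 'X_iDY) phi a b = b * phi a b.
Proof.
have -> : 'X_iY * 'X_iDY = 'X_[mono4 0 1 0 1] :> D2 R.
  by rewrite -nmonoE /nmono !expr1 !expr0 mulr1 mul1r.
by rewrite actX /mact !mono4E rfactS !rfact0 subr0 addr0 subrK !mulr1 mul1r.
Qed.

Lemma act_sop w phi a b : act (sop w) phi a b = weight w a b * phi a b.
Proof. by rewrite actD !actZ act_theta_x act_theta_y !mulrA -mulrDl. Qed.

Lemma act_eval_s w (c : {poly C}) phi a b :
  act (eval_s w c) phi a b = c.[weight w a b] * phi a b.
Proof.
have pow k : act (weyl_pow (sop w) k) phi = fun a b => weight w a b ^+ k * phi a b.
  elim: k => [|k IH]; apply: funext => x; apply: funext => y.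
    by rewrite act_1 mul1r.
  by rewrite /weyl_pow iterS act_mul -/(weyl_pow _ k) IH act_sop mulrA exprS.
rewrite act_sum horner_coef big_distrl; apply: eq_bigr => k _.
by rewrite actZ pow mulrA.
Qed.

Definition vanish_on N phi := forall a b, N a b -> phi a b = 0.

(* The functions vanishing on N then form a D-submodule. *)
Definition act_closed N := forall m a b, N a b ->
  N (a - (m iX)%:R + (m iDX)%:R) (b - (m iY)%:R + (m iDY)%:R) \/
  rfact (a - (m iX)%:R) (m iDX) * rfact (b - (m iY)%:R) (m iDY) = 0.

Lemma vanish_on_act N P phi :
  act_closed N -> vanish_on N phi -> vanish_on N (act P phi).
Proof.
move=> clN phi0 a b Nab; rewrite actE big1 // => m _; rewrite /mact.
by have [/phi0 -> | ->] := clN m a b Nab; rewrite ?mul0r !mulr0.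
Qed.

Definition weight_part w r phi a b : C := if weight w a b == r then phi a b else 0.

(** At a point of N, the initial form applied to the part of weight [r] gives either a coefficient
    of P phi, hence 0, or only zero terms. Weights are complex, so the bound is stated through a
    real difference d. *)
Lemma vanish_on_in_w w N P phi r :
    act_closed N -> (forall a b, act P phi a b = 0) ->
    (forall a b, N a b -> phi a b != 0 ->
      exists2 d : R, 0 <= d & weight w a b = r + real_complex R d) ->
  vanish_on N (act (in_w w P) (weight_part w r phi)).
Proof.
move=> clN Pphi0 ge_r a b Nab; rewrite act_sum.
pose maxw m := all (fun m' => wt w m' <= wt w m) (msupp P).
have eqw m : (weight w (a - (m iX)%:R + (m iDX)%:R) (b - (m iY)%:R + (m iDY)%:R) == r)
           = (real_complex R (wt w m) == r - weight w a b).
  by rewrite (wtE w m a b) (inj_eq (addIr _)).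
have actw m : act 'X_[m] (weight_part w r phi) a b =
    if real_complex R (wt w m) == r - weight w a b then mact m phi a b else 0.
  by rewrite actX /mact /weight_part eqw; case: ifP; rewrite ?mulr0.
have [/hasP[m0 m0P /andP[max0 /eqP eq0]] | /hasPn none] := boolP
    (has (fun m => maxw m && (real_complex R (wt w m) == r - weight w a b)) (msupp P)).
  rewrite -[RHS](Pphi0 a b) actE big_mkcond /= [LHS]big_seq [RHS]big_seq.
  apply: eq_bigr => m mP; rewrite actZ actw -/(maxw m).
  have wt_m : maxw m -> wt w m = wt w m0.
    by move=> maxm; apply/le_anti; rewrite (allP max0) // (allP maxm).
  have [maxm | nmaxm] := boolP (maxw m); first by rewrite wt_m ?eq0 ?eqxx.
  (* A contributing term starts at weight r + d with d >= 0, so its weight is at least that of [m0]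
     and it is itself of top weight. *)
  rewrite /mact; have [Ns | ->] := clN m a b Nab; last by rewrite mul0r mulr0.
  set z := phi _ _.
  have [-> | nz] := eqVneq z 0; first by rewrite !mulr0.
  have [d d0 wd] := ge_r _ _ Ns nz.
  case/negP: nmaxm; apply/allP => m' m'P; apply: le_trans (allP max0 _ m'P) _.
  suff -> : wt w m = wt w m0 + d by rewrite lerDl.
  have rD : {morph real_complex R : x y / x + y} := rmorphD _.
  by apply: complexI; rewrite [RHS]rD eq0 (wtE w m a b) wd addrAC.
rewrite big_seq_cond big1 // => m /andP[mP maxm]; rewrite actZ actw.
by case: eqP (none m mP) => [_|_ _]; rewrite ?mulr0 // andbT => /negP.
Qed.

(** The operator c(s) multiplies the lowest part by c(r), while the initial ideal sends that part to
    functions vanishing on N; at (a0, b0) this leaves c(r) = 0. *)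
Lemma in_ideal_root (I : D2 R -> Prop) w N phi (c : {poly C}) (r a0 b0 : C) :
    (forall P a b, I P -> act P phi a b = 0) -> act_closed N ->
    (forall a b, N a b -> phi a b != 0 ->
      exists2 d : R, 0 <= d & weight w a b = r + real_complex R d) ->
    N a0 b0 -> weight w a0 b0 = r -> phi a0 b0 != 0 ->
  in_ideal I w (eval_s w c) -> root c r.
Proof.
move=> Iphi clN ge_r N0 w0 phi0 [s [sI es]].
have := act_eval_s w c (weight_part w r phi) a0 b0.
rewrite es act_sum big_seq big1 => [|[Q P] /= /sI /= IP]; last first.
  rewrite act_mul; apply: vanish_on_act N0 => //.
  by apply: vanish_on_in_w => // a b; apply: Iphi.
move/esym/eqP; rewrite /weight_part w0 eqxx mulf_eq0 (negPf phi0) orbF.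
by [].
Qed.

Definition neg_int (u : C) := exists t : nat, u = - t.+1%:R.

(* Dividing out these functions turns x^a (resp. y^b) with negative integer
   exponent into derivatives of a delta function: x kills x^-1. *)
Lemma rfact_neg_int u (i c : nat) : neg_int u ->
  neg_int (u - i%:R + c%:R) \/ rfact (u - i%:R) c = 0.
Proof.
case=> t ->; case: (ltnP c (t + i).+1) => [lt | le].
  left; exists (t + i - c)%N.
  have -> : (t + i - c).+1%:R = t.+1%:R + i%:R - c%:R :> C.
    by rewrite -natrD -natrB; [congr _%:R; lia | lia].
  ring.
right; apply/eqP/rfact_eq0P; exists (t + i)%N => //.
by rewrite -!natr1 natrD; ring.
Qed.

Lemma act_closed_neg_x : act_closed (fun a _ => neg_int a).
Proof.
move=> m a b /(rfact_neg_int a (m iX) (m iDX))[|->]; first by left.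
by right; rewrite mul0r.
Qed.

Lemma act_closed_neg_y : act_closed (fun _ b => neg_int b).
Proof.
move=> m a b /(rfact_neg_int b (m iY) (m iDY))[|->]; first by left.
by right; rewrite mulr0.
Qed.

Lemma act_closed_all : act_closed (fun _ _ => True).
Proof. by left. Qed.

End InitialForms.

(** * Expansions of rational functions *)

Section RationalFunctions.
Context {R : realType}.
Local Notation C := (R[i]).
Implicit Types (phi : C -> C -> C) (g h : {mpoly C[2]}) (a b : C).

Definition pmul g phi a b : C :=
  mext (fun m => phi (a - (m vx2)%:R) (b - (m vy2)%:R) : C^o) g.

Lemma pmulE g phi a b : pmul g phi a b =
  \sum_(m <- msupp g) g@_m * phi (a - (m vx2)%:R) (b - (m vy2)%:R).
Proof. by []. Qed.

Lemma pmulX m phi a b :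
  pmul 'X_[m] phi a b = phi (a - (m vx2)%:R) (b - (m vy2)%:R).
Proof. exact: mextX. Qed.

Lemma pmulD g h phi a b : pmul (g + h) phi a b = pmul g phi a b + pmul h phi a b.
Proof. exact: linearD. Qed.

Lemma pmulB g h phi a b : pmul (g - h) phi a b = pmul g phi a b - pmul h phi a b.
Proof. exact: linearB. Qed.

Lemma pmulZ c g phi a b : pmul (c *: g) phi a b = c * pmul g phi a b.
Proof. exact: linearZ. Qed.

Lemma pmul0 phi a b : pmul 0 phi a b = 0.
Proof. exact: linear0. Qed.

Lemma pmul_sum I (r : seq I) (p : pred I) (F : I -> {mpoly C[2]}) phi a b :
  pmul (\sum_(i <- r | p i) F i) phi a b = \sum_(i <- r | p i) pmul (F i) phi a b.
Proof. exact: linear_sum. Qed.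

Lemma pmul1 phi : pmul 1 phi = phi.
Proof.
apply: funext => a; apply: funext => b.
by rewrite -mpolyX0 pmulX !mnm0E !subr0.
Qed.

Lemma pmulM g h phi : pmul (g * h) phi = pmul g (pmul h phi).
Proof.
apply: funext => a; apply: funext => b.
rewrite [g in LHS]mpolyE [h in LHS]mpolyE big_distrl pmul_sum [RHS]pmulE.
apply: eq_bigr => m _; rewrite big_distrr pmul_sum pmulE big_distrr.
apply: eq_bigr => m' _ /=.
rewrite -scalerAl -scalerAr -mpolyXD !pmulZ pmulX !mnmDE !natrD !opprD !addrA.
by [].
Qed.

Definition Dx phi a b : C := (a + 1) * phi (a + 1) b.
Definition Dy phi a b : C := (b + 1) * phi a (b + 1).

Lemma iter_Dx c phi a b : iter c Dx phi a b = rfact a c * phi (a + c%:R) b.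
Proof.
elim: c a => [|c IH] a; first by rewrite rfact0 addr0 mul1r.
by rewrite iterS /Dx IH rfactS -natr1 -!addrA [1 + _]addrC !mulrA.
Qed.

Lemma iter_Dy c phi a b : iter c Dy phi a b = rfact b c * phi a (b + c%:R).
Proof.
elim: c b => [|c IH] b; first by rewrite rfact0 addr0 mul1r.
by rewrite iterS /Dy IH rfactS -natr1 -!addrA [1 + _]addrC !mulrA.
Qed.

Lemma Dx_pmul g phi a b :
  Dx (pmul g phi) a b = pmul g^`M(vx2) phi a b + pmul g (Dx phi) a b.
Proof.
elim/mpolyind: g => [|c m g _ _ IH].
  by rewrite /Dx mderiv0 !pmul0 mulr0 addr0.
rewrite mderivD mderivZ mderivX !pmulD !pmulZ.
transitivity (c * Dx (pmul 'X_[m] phi) a b + Dx (pmul g phi) a b).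
  by rewrite /Dx pmulD pmulZ; ring.
rewrite IH !pmulX /Dx pmulX !mnmBE !mnm1E subn0.
(* At exponent 0 the derivative has coefficient 0, whatever its truncated exponent. *)
case: (m vx2) => [|k]; first by rewrite !subr0; ring.
rewrite subSS subn0 -!natr1.
have -> : a + 1 - (k%:R + 1) = a - k%:R by ring.
have -> : a - (k%:R + 1) + 1 = a - k%:R by ring.
ring.
Qed.

Lemma Dy_pmul g phi a b :
  Dy (pmul g phi) a b = pmul g^`M(vy2) phi a b + pmul g (Dy phi) a b.
Proof.
elim/mpolyind: g => [|c m g _ _ IH].
  by rewrite /Dy mderiv0 !pmul0 mulr0 addr0.
rewrite mderivD mderivZ mderivX !pmulD !pmulZ.
transitivity (c * Dy (pmul 'X_[m] phi) a b + Dy (pmul g phi) a b).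
  by rewrite /Dy pmulD pmulZ; ring.
rewrite IH !pmulX /Dy pmulX !mnmBE !mnm1E subn0.
case: (m vy2) => [|k]; first by rewrite !subr0; ring.
rewrite subSS subn0 -!natr1.
have -> : b + 1 - (k%:R + 1) = b - k%:R by ring.
have -> : b - (k%:R + 1) + 1 = b - k%:R by ring.
ring.
Qed.

Variables (f : {mpoly C[2]}) (v : nat -> C -> C -> C).
Hypotheses (f_v : forall n, pmul f (v n.+1) = v n)
  (Dx_v : forall n a b, Dx (v n) a b = - n%:R * pmul f^`M(vx2) (v n.+1) a b)
  (Dy_v : forall n a b, Dy (v n) a b = - n%:R * pmul f^`M(vy2) (v n.+1) a b).

(* g / f^n |-> g v_n commutes with the derivations. *)
Let real (gn : {mpoly C[2]} * nat) := pmul gn.1 (v gn.2).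

Let pmul_ext g phi psi a b : (forall a b, phi a b = psi a b) ->
  pmul g phi a b = pmul g psi a b.
Proof. by move=> e; rewrite !pmulE; under eq_bigr do rewrite e. Qed.

Let pmul_scale g c phi a b :
  pmul g (fun a b => c * phi a b) a b = c * pmul g phi a b.
Proof. by rewrite !pmulE big_distrr; apply: eq_bigr => m _; rewrite mulrCA. Qed.

Let real_dx gn : real (dfrac f vx2 gn) = Dx (real gn).
Proof.
apply: funext => a; apply: funext => b.
rewrite /real /dfrac /= Dx_pmul pmulB pmulZ !pmulM f_v; congr (_ + _).
by rewrite (pmul_ext _ _ _ _ _ (Dx_v _)) pmul_scale mulNr.
Qed.

Let real_dy gn : real (dfrac f vy2 gn) = Dy (real gn).
Proof.
apply: funext => a; apply: funext => b.
rewrite /real /dfrac /= Dy_pmul pmulB pmulZ !pmulM f_v; congr (_ + _).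
by rewrite (pmul_ext _ _ _ _ _ (Dy_v _)) pmul_scale mulNr.
Qed.

Let real_mono_act m gn : real (mono_act f m gn) = mact m (real gn).
Proof.
have itx k hn : real (iter k (dfrac f vx2) hn) = iter k Dx (real hn).
  elim: k => [|k IH] /=; [by [] | by rewrite real_dx -IH].
have ity k hn : real (iter k (dfrac f vy2) hn) = iter k Dy (real hn).
  elim: k => [|k IH] /=; [by [] | by rewrite real_dy -IH].
apply: funext => a; apply: funext => b.
pose hn := iter (m iDY) (dfrac f vy2) (iter (m iDX) (dfrac f vx2) gn).
transitivity (pmul ('X_vx2 ^+ m iX * 'X_vy2 ^+ m iY) (real hn) a b).
  by rewrite -[pmul _ (real hn)]pmulM.
rewrite /hn ity itx !mpolyXn -mpolyXD pmulX.
rewrite !mnmDE !mulmnE !mnm1E /= !mul1n !mul0n addn0 add0n.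
by rewrite iter_Dy iter_Dx /mact; ring.
Qed.

Lemma mono_act_order m gn : (mono_act f m gn).2 = (gn.2 + m iDX + m iDY)%N.
Proof.
rewrite /mono_act /=.
have it i k hn : (iter k (dfrac f i) hn).2 = (hn.2 + k)%N.
  by elim: k => [|k IH]; rewrite ?addn0 // iterS /= IH addnS.
by rewrite !it.
Qed.

Let pmul_expf k d : pmul (f ^+ k) (v (d + k)) = v d.
Proof.
elim: k => [|k IH]; first by rewrite expr0 pmul1 addn0.
by rewrite exprSr pmulM addnS f_v.
Qed.

Lemma act_Ann (n : nat) (P : D2 R) : Ann f (Negz n) P ->
  forall a b, act P (v n.+1) a b = 0.
Proof.
move=> annP a b.
have P0 : \sum_(m <- msupp P) P@_m *: ((mono_act f m (1, n.+1)).1 *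
    f ^+ (msize P + n.+1 - (mono_act f m (1, n.+1)).2)) = 0 := annP.
rewrite -(pmul0 (v (msize P + n.+1)) a b) -P0 pmul_sum actE.
rewrite [LHS]big_seq [RHS]big_seq; apply: eq_bigr => m mP.
rewrite pmulZ pmulM mono_act_order [(1, n.+1).2]/=; congr (_ * _).
set d := (n.+1 + _ + _)%N; set N := (msize P + _)%N.
(* The order of m is less than [msize P], so N - d is not truncated and f^(N-d) v_N = v_d. *)
have dN : (d <= N)%N.
  have := msize_mdeg_lt mP; rewrite mdegE !big_ord_recl big_ord0.
  have -> : lift ord0 (lift ord0 ord0) = iDX by apply: val_inj.
  have -> : lift ord0 (lift ord0 (lift ord0 ord0)) = iDY by apply: val_inj.
  rewrite /d /N; lia.
have -> : v N = v (d + (N - d))%N by rewrite subnKC.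
rewrite pmul_expf.
have := real_mono_act m (1, n.+1).
rewrite /real mono_act_order [(1, n.+1).2]/= -/d [(1, n.+1).1]/= pmul1.
by move->.
Qed.

End RationalFunctions.

(** * Bilateral expansions of the powers of 1 / (x^p + y^q) *)

Section Fermat.
Context {R : realType}.
Local Notation C := (R[i]).
Implicit Types (phi : C -> C -> C) (a b t : C).

(* Coefficient of z^t in the expansion of (1 - z)^-n, as a polynomial in t. *)
Definition negbin n t : C := if n is k.+1 then rfact t k / k`!%:R else 0.

(** This identity and the next one give the derivatives of the series in x and in y. *)
Lemma negbin_pred n t : n%:R * negbin n.+1 (t - 1) = t * negbin n t.
Proof.
case: n => [|k]; first by rewrite mul0r mulr0.
rewrite /negbin rfactS subrK factS natrM.
have k0 : k`!%:R != 0 :> C by rewrite pnatr_eq0 -lt0n fact_gt0.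
have k1 : k.+1%:R != 0 :> C by rewrite pnatr_eq0.
by move: (k.+1%:R) k1 => u k1; field; rewrite k0 k1.
Qed.

Lemma negbin_succ n t : n%:R * negbin n.+1 t = (t + n%:R) * negbin n t.
Proof.
case: n => [|k]; first by rewrite mul0r mulr0.
rewrite /negbin rfactSr factS natrM.
have k0 : k`!%:R != 0 :> C by rewrite pnatr_eq0 -lt0n fact_gt0.
have k1 : k.+1%:R != 0 :> C by rewrite pnatr_eq0.
by move: (k.+1%:R) k1 => u k1; field; rewrite k0 k1.
Qed.

(** Pascal's rule, behind f u_(n+1) = u_n. For n = 0 it says that 1 - z kills the bilateral
    geometric series, in accordance with [negbin 0] being 0. *)
Lemma negbin_diff n t : negbin n.+1 t - negbin n.+1 (t - 1) = negbin n t.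
Proof.
case: n => [|k]; first by rewrite /negbin !rfact0 subrr.
have k1 : k.+1%:R != 0 :> C by rewrite pnatr_eq0.
apply: (mulfI k1); rewrite mulrBr negbin_pred negbin_succ; ring.
Qed.

(** The function is (-1)^k at lam + k and 0 off lam + Z: the indicator of lam + 2Z minus that of lam
    + 2Z + 1. *)
Lemma exists_alternating (lam : C) : exists eps : C -> C,
  [/\ eps lam = 1, forall t, eps (t - 1) = - eps t &
      forall t, eps t != 0 -> exists k : int, t = lam + k%:~R].
Proof.
pose ev t := `[< exists k : int, t = lam + (2 * k)%:~R >].
pose od t := `[< exists k : int, t = lam + (2 * k + 1)%:~R >].
exists (fun t => (ev t)%:R - (od t)%:R); split => [|t|t].
- have -> : ev lam by apply/asboolP; exists 0; rewrite mulr0 addr0.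
  have -> : od lam = false.
    apply/asboolP => -[k]; rewrite -[LHS]addr0 => /addrI /esym/eqP.
    by rewrite intr_eq0 => /eqP; lia.
  by rewrite subr0.
- have -> : ev (t - 1) = od t.
    by apply: asbool_equiv_eq; split=> -[k e]; exists k;
      move: e; rewrite intrD => /eqP e; apply/eqP; move: e;
      rewrite ?addrA ?subr_eq // -subr_eq.
  have -> : od (t - 1) = ev t.
    apply: asbool_equiv_eq; split=> -[k e].
      exists (k + 1); rewrite -[LHS](subrK 1) e !(intrD, intrM); ring.
    exists (k - 1); rewrite e !(intrD, intrM, rmorphN); ring.
  by rewrite opprB.
- case: (boolP (ev t)) => [/asboolP[k ->] _|_]; first by exists (2 * k).
  case: (boolP (od t)) => [/asboolP[k ->] _|_]; first by exists (2 * k + 1).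
  by rewrite subrr eqxx.
Qed.

Variables (p q : nat).
Hypotheses (p_gt0 : (0 < p)%N) (q_gt0 : (0 < q)%N).
Let p0 : p%:R != 0 :> C. Proof. by rewrite pnatr_eq0 -lt0n. Qed.
Let q0 : q%:R != 0 :> C. Proof. by rewrite pnatr_eq0 -lt0n. Qed.

Definition fermat : {mpoly C[2]} := 'X_vx2 ^+ p + 'X_vy2 ^+ q.

Lemma fermatE : fermat = 'X_[U_(vx2) *+ p] + 'X_[U_(vy2) *+ q].
Proof. by rewrite /fermat !mpolyXn. Qed.

Lemma fermat_dx : fermat^`M(vx2) = p%:R *: 'X_[U_(vx2) *+ p.-1].
Proof.
rewrite fermatE mderivD !mderivX !mulmnE !mnm1E /= mul1n mul0n scale0r addr0.
by rewrite -{2}(prednK p_gt0) mulmS addmC addmK.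
Qed.

Lemma fermat_dy : fermat^`M(vy2) = q%:R *: 'X_[U_(vy2) *+ q.-1].
Proof.
rewrite fermatE mderivD !mderivX !mulmnE !mnm1E /= mul1n mul0n scale0r add0r.
by rewrite -{2}(prednK q_gt0) mulmS addmC addmK.
Qed.

(* The bilateral expansion of (x^p + y^q)^-n with exponents of x in p (lam + Z),
   lam being the point where the support of eps is based. *)
Definition fermat_series (eps : C -> C) n a b : C :=
  if b == - (q%:R * (a / p%:R + n%:R)) then eps (a / p%:R) * negbin n (a / p%:R)
  else 0.

Section Series.
Variable eps : C -> C.
Hypothesis eps_pred : forall t, eps (t - 1) = - eps t.

(** Both terms of f lead to the same line of exponents, and the sign rule of [eps] turns their sum
    into the difference of [negbin_diff]. *)
Lemma fermat_series_mul n :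
  pmul fermat (fermat_series eps n.+1) = fermat_series eps n.
Proof.
apply: funext => a; apply: funext => b.
rewrite fermatE pmulD !pmulX !mulmnE !mnm1E /= !mul1n !mul0n !subr0.
rewrite /fermat_series.
have -> : (a - p%:R) / p%:R = a / p%:R - 1 by field.
set t := a / p%:R.
have -> : t - 1 + n.+1%:R = t + n%:R by rewrite -natr1; ring.
have -> : (b - q%:R == - (q%:R * (t + n.+1%:R))) = (b == - (q%:R * (t + n%:R))).
  by rewrite subr_eq -natr1; congr (_ == _); ring.
case: ifP => _; last by rewrite addr0.
by rewrite eps_pred -(negbin_diff n t); ring.
Qed.

Lemma fermat_series_dx n a b : Dx (fermat_series eps n) a b =
  - n%:R * pmul fermat^`M(vx2) (fermat_series eps n.+1) a b.
Proof.
rewrite fermat_dx pmulZ pmulX !mulmnE !mnm1E /= mul1n mul0n subr0.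
rewrite /Dx /fermat_series.
have pE : p.-1%:R = p%:R - 1 :> C by rewrite -[in RHS](prednK p_gt0) -natr1 addrK.
have -> : (a - p.-1%:R) / p%:R = (a + 1) / p%:R - 1 by rewrite pE; field.
have -> : a + 1 = p%:R * ((a + 1) / p%:R) by field.
rewrite [_ * _ / p%:R]mulrAC divff // mul1r; set t := (a + 1) / _.
have -> : t - 1 + n.+1%:R = t + n%:R by rewrite -natr1; ring.
case: ifP => _; last by rewrite !mulr0.
transitivity (p%:R * eps t * (t * negbin n t)); first by ring.
by rewrite -negbin_pred eps_pred; ring.
Qed.

Lemma fermat_series_dy n a b : Dy (fermat_series eps n) a b =
  - n%:R * pmul fermat^`M(vy2) (fermat_series eps n.+1) a b.
Proof.
rewrite fermat_dy pmulZ pmulX !mulmnE !mnm1E /= mul1n mul0n subr0.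
rewrite /Dy /fermat_series; set t := a / _.
have qE : q.-1%:R = q%:R - 1 :> C by rewrite -[in RHS](prednK q_gt0) -natr1 addrK.
have -> : (b - q.-1%:R == - (q%:R * (t + n.+1%:R)))
          = (b + 1 == - (q%:R * (t + n%:R))).
  by rewrite subr_eq -[RHS](inj_eq (addIr (-1))) addrK qE -natr1; congr (_ == _); ring.
case: eqP => [-> | _]; last by rewrite !mulr0.
transitivity (- q%:R * eps t * ((t + n%:R) * negbin n t)); first by ring.
by rewrite -negbin_succ; ring.
Qed.

Lemma act_Ann_fermat n P a b : Ann fermat (Negz n) P ->
  act P (fermat_series eps n.+1) a b = 0.
Proof.
move=> annP; apply: (act_Ann fermat) annP _ _.
- exact: fermat_series_mul.
- exact: fermat_series_dx.
- exact: fermat_series_dy.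
Qed.
End Series.

End Fermat.

(** * Elements of the initial ideal *)

Section LeftIdeal.
Context {R : realType}.
Local Notation C := (R[i]).
Implicit Types (P Q : D2 R) (phi : C -> C -> C) (a b : C) (g h : C -> C -> C).
Variables (I : D2 R -> Prop) (w : R * R).

(** Replacing such operators by their eigenvalues g(a, b) makes computations modulo the initial
    ideal commutative. *)
Definition diagonal g P := forall phi a b, act P phi a b = g a b * phi a b.

Definition diag_op g := exists P, diagonal g P.
Definition diag_ideal g := exists2 P, diagonal g P & in_ideal I w P.

Lemma diagonal_inj g P Q : diagonal g P -> diagonal g Q -> P = Q.
Proof.
move=> dP dQ; apply: act_inj => phi; apply: funext => a; apply: funext => b.
by rewrite dP dQ.
Qed.

Lemma diagonal_mul g h P Q :
  diagonal g P -> diagonal h Q -> diagonal (fun a b => g a b * h a b) (weyl_mul P Q).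
Proof. by move=> dP dQ phi a b; rewrite act_mul dP dQ mulrA. Qed.

Lemma diag_op_ext g h : (forall a b, g a b = h a b) -> diag_op g -> diag_op h.
Proof. by move=> gh [P dP]; exists P => phi a b; rewrite dP gh. Qed.

Lemma diag_op_const c : diag_op (fun _ _ => c).
Proof. by exists (c *: 1) => phi a b; rewrite actZ act_1. Qed.

Lemma diag_op_x : diag_op (fun a _ => a).
Proof. by exists ('X_iX * 'X_iDX) => phi a b; rewrite act_theta_x. Qed.

Lemma diag_op_y : diag_op (fun _ b => b).
Proof. by exists ('X_iY * 'X_iDY) => phi a b; rewrite act_theta_y. Qed.

Lemma diag_op_add g h : diag_op g -> diag_op h -> diag_op (fun a b => g a b + h a b).
Proof. by case=> P dP [Q dQ]; exists (P + Q) => phi a b; rewrite actD dP dQ mulrDl. Qed.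

Lemma diag_op_mul g h : diag_op g -> diag_op h -> diag_op (fun a b => g a b * h a b).
Proof. by case=> P dP [Q dQ]; exists (weyl_mul P Q); apply: diagonal_mul. Qed.

Lemma diag_op_eval (d : {poly C}) : diag_op (fun a b => d.[weight w a b]).
Proof. by exists (eval_s w d) => phi a b; rewrite act_eval_s. Qed.

Lemma in_idealD P Q : in_ideal I w P -> in_ideal I w Q -> in_ideal I w (P + Q).
Proof.
case=> [s [sI ->]] [s' [s'I ->]]; exists (s ++ s'); split; last by rewrite big_cat.
by move=> qp; rewrite mem_cat => /orP[/sI|/s'I].
Qed.

Lemma in_ideal_mul Q P : in_ideal I w P -> in_ideal I w (weyl_mul Q P).
Proof.
case=> [s [sI ->]]; exists [seq (weyl_mul Q qp.1, qp.2) | qp <- s]; split.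
  by move=> qp /mapP[qp' /sI Iqp ->].
rewrite big_map; apply: act_inj => phi; apply: funext => a; apply: funext => b.
rewrite act_mul.
have -> : act (\sum_(qp <- s) weyl_mul qp.1 (in_w w qp.2)) phi =
    fun a b => \sum_(qp <- s) 1 * act qp.1 (act (in_w w qp.2) phi) a b.
  apply: funext => x; apply: funext => y; rewrite act_sum.
  by apply: eq_bigr => qp _; rewrite act_mul mul1r.
rewrite actE act_sum.
under eq_bigr => m _ do rewrite mact_sum big_distrr.
rewrite exchange_big /=; apply: eq_bigr => qp _.
by rewrite !act_mul [RHS]actE; apply: eq_bigr => m _; rewrite mul1r.
Qed.

Lemma in_ideal_in_w P : I P -> in_ideal I w (in_w w P).
Proof.
move=> IP; exists [:: (1, P)]; split=> [qp|]; first by rewrite inE => /eqP ->.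
rewrite big_seq1; apply: act_inj => phi.
by rewrite act_mul act_1.
Qed.

Lemma diag_ideal_ext g h :
  (forall a b, g a b = h a b) -> diag_ideal g -> diag_ideal h.
Proof. by move=> gh [P dP]; exists P => // phi a b; rewrite dP gh. Qed.

Lemma diag_ideal_add g h :
  diag_ideal g -> diag_ideal h -> diag_ideal (fun a b => g a b + h a b).
Proof.
case=> P dP IP [Q dQ IQ]; exists (P + Q); last exact: in_idealD.
by move=> phi a b; rewrite actD dP dQ mulrDl.
Qed.

Lemma diag_ideal_mul g h :
  diag_op g -> diag_ideal h -> diag_ideal (fun a b => g a b * h a b).
Proof.
case=> P dP [Q dQ IQ]; exists (weyl_mul P Q); last exact: in_ideal_mul.
exact: diagonal_mul.
Qed.

Lemma diag_ideal_eval_s (c : {poly C}) :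
  diag_ideal (fun a b => c.[weight w a b]) -> in_ideal I w (eval_s w c).
Proof.
case=> P dP IP; rewrite (diagonal_inj _ (eval_s w c) P _ dP) // => phi a b.
by rewrite act_eval_s.
Qed.

Lemma diag_op_rfact g n : diag_op g -> diag_op (fun a b => rfact (g a b) n).
Proof.
move=> Dg; elim: n => [|n IH].
  by apply: (diag_op_ext (fun _ _ => 1)) (diag_op_const 1) => a b; rewrite rfact0.
apply: (diag_op_ext (fun a b => rfact (g a b) n * (g a b + n.+1%:R))) => [a b|].
  by rewrite rfactSr.
by apply: diag_op_mul => //; apply: diag_op_add => //; apply: diag_op_const.
Qed.

(** Modulo e each factor is k (z + i). The cofactor A is a diagonal operator, so A e lies in the
    left ideal whenever e does. *)
Lemma prod_mod_ideal (e z : C -> C -> C) (k l : C) n : diag_op e -> diag_op z ->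
  exists2 A, diag_op A & forall a b,
    \prod_(1 <= i < n.+1) (k * (z a b + i%:R) + l * e a b) =
    k ^+ n * rfact (z a b) n + A a b * e a b.
Proof.
move=> De Dz; elim: n => [|n [A DA IH]].
  exists (fun _ _ => 0); first exact: diag_op_const.
  by move=> a b; rewrite big_geq // rfact0 mul0r addr0 mulr1.
exists (fun a b => A a b * (k * (z a b + n.+1%:R) + l * e a b) +
    l * k ^+ n * rfact (z a b) n).
  apply: diag_op_add; apply: diag_op_mul => //; last exact: diag_op_rfact.
    apply: diag_op_add; apply: diag_op_mul => //; try exact: diag_op_const.
    by apply: diag_op_add => //; apply: diag_op_const.
  exact: diag_op_const.
by move=> a b; rewrite big_nat_recr //= IH rfactSr exprS; ring.
Qed.

(** Modulo e the product is the scalar k' k^n times u (z + 1) ... (z + n), which is in the ideal; d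
    allows for multiples. *)
Lemma diag_ideal_prod (d e u z : C -> C -> C) (k l k' l' : C) n :
    diag_op d -> diag_op e -> diag_op u -> diag_op z ->
    diag_ideal e -> diag_ideal (fun a b => u a b * rfact (z a b) n) ->
  diag_ideal (fun a b => d a b * ((k' * u a b + l' * e a b) *
    \prod_(1 <= i < n.+1) (k * (z a b + i%:R) + l * e a b))).
Proof.
move=> Dd De Du Dz Ie Iu; have [A DA prodE] := prod_mod_ideal e z k l n De Dz.
have Dr := diag_op_rfact z n Dz.
have Dc (c : C) g : diag_op g -> diag_op (fun a b => c * g a b).
  by move=> Dg; apply: diag_op_mul => //; apply: diag_op_const.
apply: diag_ideal_mul => //.
apply: (diag_ideal_ext (fun a b => k' * k ^+ n * (u a b * rfact (z a b) n) +
    (k' * (u a b * A a b) +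
     l' * (k ^+ n * rfact (z a b) n + A a b * e a b)) * e a b)).
  by move=> a b; rewrite prodE; ring.
apply: diag_ideal_add; apply: diag_ideal_mul => //; first exact: diag_op_const.
apply: diag_op_add; apply: (Dc); first exact: diag_op_mul.
by apply: diag_op_add; [apply: (Dc) | apply: diag_op_mul].
Qed.

End LeftIdeal.

(** * Initial forms of homogeneous operators and of binomials *)

Section InitialForm.
Context {R : realType}.
Local Notation C := (R[i]).
Implicit Types (w : R * R) (P : D2 R).

Lemma in_w_mext w P : in_w w P =
  mext (fun m => if all (fun m' => wt w m' <= wt w m) (msupp P) then 'X_[m] else 0) P.
Proof.
rewrite /in_w big_mkcond /=; apply: eq_bigr => m _.
by case: ifP; rewrite ?scaler0.
Qed.

Lemma in_w_homogeneous w P c :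
  (forall m, m \in msupp P -> wt w m = c) -> in_w w P = P.
Proof.
move=> Pc; rewrite [RHS]mpolyE in_w_mext /mext !big_seq.
apply: eq_bigr => m mP; have -> // : all (fun m' => wt w m' <= wt w m) (msupp P).
by apply/allP => m' m'P; rewrite !Pc.
Qed.

Lemma in_w_binomial w (m1 m2 : 'X_{1..4}) (c1 c2 : C) :
  c1 != 0 -> wt w m2 < wt w m1 ->
  in_w w (c1 *: 'X_[m1] + c2 *: 'X_[m2]) = c1 *: 'X_[m1].
Proof.
move=> c10 lt21; set P := _ + _.
have n12 : m2 != m1 by apply: contraTneq lt21 => ->; rewrite ltxx.
have m1P : m1 \in msupp P.
  by rewrite mcoeff_msupp mcoeffD !mcoeffZ !mcoeffX eqxx (negPf n12) mulr0 addr0 mulr1.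
rewrite in_w_mext linearD !linearZ /= !mextX.
case: ifP => [_|/negP[]]; last first.
  apply/allP => m; rewrite mcoeff_msupp mcoeffD !mcoeffZ !mcoeffX.
  case: (m1 =P m) => [->|_]; first by rewrite lexx.
  by case: (m2 =P m) => [<-|_]; rewrite ?(ltW lt21) // !mulr0 addr0 eqxx.
case: ifP => [/allP/(_ _ m1P)|_]; first by rewrite leNgt lt21.
by rewrite scaler0 addr0.
Qed.
End InitialForm.

(** * Forced roots, from the lowest terms of the expansions *)

Section Roots.
Context {R : realType}.
Local Notation C := (R[i]).
Variables (p q n : nat) (w : R * R).
Hypotheses (p_gt0 : (0 < p)%N) (q_gt0 : (0 < q)%N).
Let p0 : p%:R != 0 :> C. Proof. by rewrite pnatr_eq0 -lt0n. Qed.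
Let q0 : q%:R != 0 :> C. Proof. by rewrite pnatr_eq0 -lt0n. Qed.
Local Notation I := (Ann (fermat p q) (Negz n)).
Local Notation delta := (p%:R * w.1 - q%:R * w.2).

(** The term of index k weighs k [delta] more than that of index 0, and its coefficient is nonzero
    only if [rfact (lam + k) n] is; the condition on k says that no term on N is lighter than the
    one at k = 0. *)
Lemma fermat_root (N : C -> C -> Prop) (lam : C) (c : {poly C}) :
    act_closed N -> N (p%:R * lam) (- (q%:R * (lam + n.+1%:R))) ->
    rfact lam n != 0 ->
    (forall k : int,
      N (p%:R * (lam + k%:~R)) (- (q%:R * (lam + k%:~R + n.+1%:R))) ->
      rfact (lam + k%:~R) n != 0 -> 0 <= k%:~R * delta) ->
    in_ideal I w (eval_s w c) ->
  root c (weight w (p%:R * lam) (- (q%:R * (lam + n.+1%:R)))).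
Proof.
move=> clN N0 lam0 Nk; have [eps [eps1 epsN eps_supp]] := exists_alternating lam.
have n0 : n`!%:R != 0 :> C by rewrite pnatr_eq0 -lt0n fact_gt0.
apply: (in_ideal_root _ w N (fermat_series p q eps n.+1) c _
  (p%:R * lam) (- (q%:R * (lam + n.+1%:R)))) => //.
- by move=> P a b; apply: act_Ann_fermat.
- move=> a b Nab; rewrite /fermat_series.
  case: (b =P _) => [eb | _]; last by rewrite eqxx.
  rewrite mulf_eq0 negb_or => /andP[/eps_supp[k ea]]; move: eb; rewrite ea => eb.
  rewrite /negbin mulf_eq0 negb_or => /andP[nz _].
  have ea' : a = p%:R * (lam + k%:~R) by rewrite -ea mulrC divfK.
  exists (k%:~R * delta); first by apply: Nk nz; rewrite -ea' -eb.
  rewrite ea' eb /weight !(rmorphM, rmorphB, rmorph_int, rmorph_nat) /=; ring.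
- rewrite /fermat_series.
  have -> : p%:R * lam / p%:R = lam by field.
  by rewrite eqxx eps1 mul1r /negbin mulf_neq0 // invr_eq0.
Qed.

(** For integer [lam], this gap of n zero coefficients separates the two one-sided expansions. *)
Lemma rfact_int_eq0 (k : int) : k < 0 -> - n%:Z <= k -> rfact (k%:~R : C) n = 0.
Proof.
move=> k0 kn; apply/eqP/rfact_eq0P; exists `|k|.-1; first by lia.
have -> : `|k|.-1.+1%:R = (- k)%:~R :> C.
  by rewrite -[_%:R]/(_%:Z%:~R); congr _%:~R; lia.
by rewrite rmorphN subrr.
Qed.

(** Here [lam] places the term k = 0 at y^(-i). For i < q the terms with k < 0 have positive powers
    of y; for i = q (n+1), where [lam] is 0, those with negative powers of y fall in the gap of
    [rfact_int_eq0]. *)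
Lemma fermat_root_y (i : nat) (c : {poly C}) :
    0 < delta -> (0 < i)%N -> (i < q)%N || (i == q * n.+1)%N ->
    in_ideal I w (eval_s w c) ->
  root c (weight w (p%:R * (i%:R / q%:R - n.+1%:R)) (- i%:R)).
Proof.
move=> d0 i0 iq; set lam := _ - _.
have Eb (k : int) : q%:R * (lam + k%:~R + n.+1%:R) = (i%:Z + q%:Z * k)%:~R.
  by rewrite /lam intrD intrM -!pmulrn; field.
have Eb0 : q%:R * (lam + n.+1%:R) = i%:R by rewrite /lam; field.
rewrite -Eb0; apply: (fermat_root (fun _ b => neg_int b)).
- exact: act_closed_neg_y.
- by exists i.-1; rewrite Eb0 prednK.
(* A zero factor would make i one of q, 2q, ..., nq. *)
- apply/negP => /rfact_eq0P[s sn /eqP].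
  rewrite -(mulrI_eq0 _ (lregP q0)) => /eqP e.
  have : (i + q * s.+1)%N%:R = (q * n.+1)%N%:R :> C.
    by rewrite natrD !natrM -[RHS](add0r) -e /lam; field.
  move/eqP; rewrite eqr_nat => /eqP; case/orP: iq => [|/eqP ->]; nia.
- move=> k [t]; rewrite Eb => /oppr_inj; rewrite pmulrn => /intr_inj e nz.
  rewrite mulr_ge0 ?(ltW d0) // ler0z leNgt; apply/negP => k0.
  case/orP: iq => [iq | /eqP ei]; first nia.
  move: nz; have -> : lam = 0 by rewrite /lam ei natrM; field.
  by rewrite add0r rfact_int_eq0 ?eqxx //; nia.
Qed.

(** As [delta] < 0, the terms to exclude have k > 0. For i < p they have positive powers of x; for i
    = p (n+1), where [lam] is -(n+1), those with negative powers of x fall in the gap. *)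
Lemma fermat_root_x (i : nat) (c : {poly C}) :
    delta < 0 -> (0 < i)%N -> (i < p)%N || (i == p * n.+1)%N ->
    in_ideal I w (eval_s w c) ->
  root c (weight w (- i%:R) (- (q%:R * (n.+1%:R - i%:R / p%:R)))).
Proof.
move=> d0 i0 ip; set lam : C := - (i%:R / p%:R).
have Ea (k : int) : p%:R * (lam + k%:~R) = (p%:Z * k - i%:Z)%:~R.
  by rewrite /lam intrB intrM -!pmulrn; field.
have Ea0 : p%:R * lam = - i%:R by rewrite /lam; field.
rewrite -Ea0 [n.+1%:R + _]addrC; apply: (fermat_root (fun a _ => neg_int a)).
- exact: act_closed_neg_x.
- by exists i.-1; rewrite Ea0 prednK.
- apply/negP => /rfact_eq0P[s sn /eqP].
  rewrite -(mulrI_eq0 _ (lregP p0)) => /eqP e.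
  have : (p * s.+1)%N%:R = i%:R :> C.
    by rewrite natrM -[RHS](add0r) -e /lam; field.
  move/eqP; rewrite eqr_nat => /eqP; case/orP: ip => [|/eqP ->]; nia.
- move=> k [t]; rewrite Ea => e nz.
  have {}e : (p%:Z * k - i%:Z) = - t.+1%:Z.
    by apply: (@intr_inj C); rewrite e rmorphN.
  rewrite mulr_le0 ?(ltW d0) // lerz0 leNgt; apply/negP => k0.
  case/orP: ip => [ip | /eqP ei]; first nia.
  move: nz; have -> : lam = (- n.+1%:Z)%:~R.
    by rewrite /lam ei natrM mulrNz -pmulrn; field.
  by rewrite -intrD rfact_int_eq0 ?eqxx //; nia.
Qed.

(** All terms of the series have the same weight, so nothing is divided out. *)
Lemma fermat_root_homogeneous (c : {poly C}) :
    delta = 0 -> in_ideal I w (eval_s w c) ->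
  root c (weight w 0 (- (q%:R * n.+1%:R))).
Proof.
move=> d0; rewrite -{1}(mulr0 p%:R) -[n.+1%:R]add0r.
apply: (fermat_root (fun _ _ => True)) => // [||k _ _].
- exact: act_closed_all.
- exact: rfact_0_neq0.
- by rewrite d0 mulr0.
Qed.

End Roots.

(** * Two operators in Ann(f^l) and their initial forms *)

Section Generators.
Context {R : realType}.
Local Notation C := (R[i]).
Variables (p q n : nat) (w : R * R).
Hypotheses (p_gt0 : (0 < p)%N) (q_gt0 : (0 < q)%N).
Let p0 : p%:R != 0 :> C. Proof. by rewrite pnatr_eq0 -lt0n. Qed.
Let q0 : q%:R != 0 :> C. Proof. by rewrite pnatr_eq0 -lt0n. Qed.
Local Notation f := (fermat p q : {mpoly C[2]}).
Local Notation I := (Ann f (Negz n)).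

Definition euler_op : D2 R :=
  p%:R^-1 *: 'X_[mono4 1 0 1 0] + q%:R^-1 *: 'X_[mono4 0 1 0 1]
  + n.+1%:R *: 'X_[mono4 0 0 0 0].

(** The vector field f_y dx - f_x dy, which kills every function of f. *)
Definition hamilton_op : D2 R :=
  q%:R *: 'X_[mono4 0 q.-1 1 0] + (- p%:R) *: 'X_[mono4 p.-1 0 0 1].

(** The summand of [annihilates] with the size bound N left free, so that the sizes of the two
    operators need not be computed. *)
Definition Ann_term N (m : 'X_{1..4}) : {mpoly C[2]} :=
  (mono_act f m (1, n.+1)).1 * f ^+ (N + n.+1 - (mono_act f m (1, n.+1)).2).

Lemma Ann_mext (P : D2 R) : I P <-> mext (Ann_term (msize P)) P = 0.
Proof. by []. Qed.

Lemma Ann_term_dx N i j : Ann_term N (mono4 i j 1 0) =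
  (- n.+1%:R) *: ('X_vx2 ^+ i * 'X_vy2 ^+ j * f^`M(vx2) * f ^+ N.-1).
Proof.
rewrite /Ann_term mono_act_order /mono_act !mono4E /= -mpolyC1 mderivC mpolyC1.
have -> : (N + n.+1 - (n.+1 + 1 + 0) = N.-1)%N by lia.
by rewrite mul0r sub0r mul1r -scaleNr -scalerAr -scalerAl.
Qed.

Lemma Ann_term_dy N i j : Ann_term N (mono4 i j 0 1) =
  (- n.+1%:R) *: ('X_vx2 ^+ i * 'X_vy2 ^+ j * f^`M(vy2) * f ^+ N.-1).
Proof.
rewrite /Ann_term mono_act_order /mono_act !mono4E /= -mpolyC1 mderivC mpolyC1.
have -> : (N + n.+1 - (n.+1 + 0 + 1) = N.-1)%N by lia.
by rewrite mul0r sub0r mul1r -scaleNr -scalerAr -scalerAl.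
Qed.

Lemma Ann_term_1 N : Ann_term N (mono4 0 0 0 0) = f ^+ N.
Proof. by rewrite /Ann_term /mono_act !mono4E /= !mul1r addnK. Qed.

Lemma hamilton_op_Ann : I hamilton_op.
Proof.
apply/Ann_mext; move: (msize _) => N; rewrite /hamilton_op.
rewrite linearD !linearZ /= !mextX Ann_term_dx Ann_term_dy.
rewrite fermat_dx // fermat_dy // -!mpolyXn !expr0 !mul1r !mulr1.
rewrite -!scalerAr -!scalerAl !scalerA ['X_vx2 ^+ _ * _]mulrC -scalerDl.
rewrite [X in X *: _](_ : _ = 0) ?scale0r //; ring.
Qed.

Lemma euler_op_Ann : I euler_op.
Proof.
(* The step f^N = f f^(N-1) requires N > 0; size 0 would mean the zero operator. *)
apply/Ann_mext; have [P0 | ] := posnP (msize euler_op).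
  by move/eqP: P0; rewrite msize_poly_eq0 => /eqP ->; rewrite linear0.
move: (msize _) => [//|N] _; rewrite /euler_op.
rewrite !linearD !linearZ /= !mextX Ann_term_dx Ann_term_dy Ann_term_1.
rewrite fermat_dx // fermat_dy // -!mpolyXn !expr0 !expr1 mul1r mulr1 /=.
rewrite -!scalerAr -!scalerAl !scalerA -!exprS !prednK //.
have -> : p%:R^-1 * - n.+1%:R * p%:R = - n.+1%:R :> C by field.
have -> : q%:R^-1 * - n.+1%:R * q%:R = - n.+1%:R :> C by field.
by rewrite -scalerDr -mulrDl -/(fermat p q) -exprS scaleNr addNr.
Qed.

Lemma act_euler_op phi a b :
  act euler_op phi a b = (a / p%:R + b / q%:R + n.+1%:R) * phi a b.
Proof.
rewrite !actD !actZ !actX /mact !mono4E !rfactS !rfact0 !subr0 !addr0 !subrK.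
ring.
Qed.

Lemma diag_ideal_euler :
  diag_ideal I w (fun a b => a / p%:R + b / q%:R + n.+1%:R).
Proof.
exists euler_op; first exact: act_euler_op.
(* All terms have weight 0, so the operator is its own initial form. *)
rewrite -(in_w_homogeneous w euler_op 0); first exact/in_ideal_in_w/euler_op_Ann.
move=> m; rewrite mcoeff_msupp !mcoeffD !mcoeffZ !mcoeffX => m_supp.
have : [|| mono4 1 0 1 0 == m, mono4 0 1 0 1 == m | mono4 0 0 0 0 == m].
  apply: contraNT m_supp; rewrite !negb_or => /and3P[/negPf-> /negPf-> /negPf->].
  by rewrite !mulr0 !addr0.
by case/or3P=> /eqP <-; rewrite /wt !mono4E; ring.
Qed.

(** The initial form is q y^(q-1) dx; x dy^(q-1) on its left gives q theta_x (theta_y + 1) ...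
    (theta_y + q - 1), and q is divided out. *)
Lemma diag_ideal_hamilton_x : q%:R * w.2 < p%:R * w.1 ->
  diag_ideal I w (fun a b => a * rfact b q.-1).
Proof.
move=> lt_w; apply: diag_ideal_ext.
  by move=> a b; symmetry; rewrite -[LHS](mulKf q0).
apply: diag_ideal_mul; first exact: diag_op_const.
exists (weyl_mul 'X_[mono4 1 0 0 q.-1] (in_w w hamilton_op)); last first.
  exact/in_ideal_mul/in_ideal_in_w/hamilton_op_Ann.
rewrite in_w_binomial //; last first.
  have e : wt w (mono4 0 q.-1 1 0) - wt w (mono4 p.-1 0 0 1)
         = p%:R * w.1 - q%:R * w.2.
    rewrite /wt !mono4E -{2}(prednK p_gt0) -{2}(prednK q_gt0) -!natr1; ring.
  by rewrite -subr_gt0 e subr_gt0.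
move=> phi a b; rewrite act_mul actX /mact !mono4E actZ actX /mact !mono4E.
by rewrite rfactS !rfact0 !subr0 !addr0 !subrK addrK; ring.
Qed.

(** The initial form is now the other term, -p x^(p-1) dy, and the left factor is y dx^(p-1). *)
Lemma diag_ideal_hamilton_y : p%:R * w.1 < q%:R * w.2 ->
  diag_ideal I w (fun a b => b * rfact a p.-1).
Proof.
have np0 : - p%:R != 0 :> C by rewrite oppr_eq0.
move=> lt_w; apply: diag_ideal_ext.
  by move=> a b; symmetry; rewrite -[LHS](mulKf np0).
apply: diag_ideal_mul; first exact: diag_op_const.
exists (weyl_mul 'X_[mono4 0 1 p.-1 0] (in_w w hamilton_op)); last first.
  exact/in_ideal_mul/in_ideal_in_w/hamilton_op_Ann.
rewrite /hamilton_op addrC in_w_binomial //; last first.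
  have e : wt w (mono4 p.-1 0 0 1) - wt w (mono4 0 q.-1 1 0)
         = q%:R * w.2 - p%:R * w.1.
    rewrite /wt !mono4E -{2}(prednK p_gt0) -{2}(prednK q_gt0) -!natr1; ring.
  by rewrite -subr_gt0 e subr_gt0.
move=> phi a b; rewrite act_mul actX /mact !mono4E actZ actX /mact !mono4E.
by rewrite rfactS !rfact0 !subr0 !addr0 !subrK addrK; ring.
Qed.

End Generators.

(** * The b-function *)

Section BFunction.
Context {R : realType}.
Local Notation C := (R[i]).

(** Forced roots bound the b-function from below, membership of the product from above; as the roots
    are distinct, the linear factors divide jointly. *)
Lemma is_bfunction_roots (I : D2 R -> Prop) (w : R * R) (rs : seq C) :
    uniq rs ->
    (forall c z, z \in rs -> in_ideal I w (eval_s w c) -> root c z) ->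
    (forall d, in_ideal I w (eval_s w (d * \prod_(z <- rs) ('X - z%:P)))) ->
  is_bfunction I w (\prod_(z <- rs) ('X - z%:P)) /\
  separable_poly (\prod_(z <- rs) ('X - z%:P)).
Proof.
move=> rs_uniq rs_root rs_mul; split; last by rewrite separable_prod_XsubC.
split=> [|c]; first exact: monic_prod_XsubC.
split=> [cI | /dvdpP[d ->]]; last exact: rs_mul.
apply: uniq_roots_dvdp; last by rewrite uniq_rootsE.
by apply/allP => z /rs_root; apply.
Qed.

Variables (p q n : nat) (w : R * R).
Hypotheses (p_gt0 : (0 < p)%N) (q_gt0 : (0 < q)%N).
Let p0 : p%:R != 0 :> C. Proof. by rewrite pnatr_eq0 -lt0n. Qed.
Let q0 : q%:R != 0 :> C. Proof. by rewrite pnatr_eq0 -lt0n. Qed.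
Local Notation I := (Ann (fermat p q) (Negz n)).
Local Notation w1 := (real_complex R w.1).
Local Notation w2 := (real_complex R w.2).

Let diag_op_euler : diag_op (fun a b : C => a / p%:R + b / q%:R + n.+1%:R).
Proof. by exists (euler_op p q n) => phi a b; apply: act_euler_op. Qed.

Lemma delta_neq0 :
  p%:R * w.1 - q%:R * w.2 != 0 -> p%:R * w1 - q%:R * w2 != 0.
Proof.
have -> : p%:R * w1 - q%:R * w2 = real_complex R (p%:R * w.1 - q%:R * w.2).
  by rewrite !(rmorphM, rmorphB, rmorph_nat).
by rewrite fmorph_eq0.
Qed.

Let root_y i := weight w (p%:R * (i%:R / q%:R - n.+1%:R)) (- i%:R).

Lemma is_bfunction_y (B : {poly C}) : q%:R * w.2 < p%:R * w.1 ->
  B = \prod_(z <- [seq root_y i | i <- q * n.+1 :: index_iota 1 q]%N)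
        ('X - z%:P) ->
  is_bfunction I w B /\ separable_poly B.
Proof.
move=> lt_w ->; have d_gt0 : 0 < p%:R * w.1 - q%:R * w.2 by rewrite subr_gt0.
have d0 := delta_neq0 (lt0r_neq0 d_gt0).
apply: is_bfunction_roots.
- rewrite map_inj_uniq => [|i j].
    by rewrite /= iota_uniq mem_index_iota andbT; apply/negP; nia.
  rewrite /root_y /weight => e; apply/eqP; rewrite -(eqr_nat C) -subr_eq0.
  (* Two roots differ by (i - j) (p w1 - q w2) / q. *)
  have : (i%:R - j%:R) * (p%:R * w1 - q%:R * w2) = 0 :> C.
    by apply: (mulIf (invr_neq0 q0)); rewrite mul0r -[RHS](subrr (root_y j))
      /root_y /weight -{1}e; field.
  by move/eqP; rewrite mulf_eq0 (negPf d0) orbF.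
- move=> c z /mapP[i i_in ->]; apply: fermat_root_y => //.
    by move: i_in; rewrite inE mem_index_iota => /orP[/eqP ->|/andP[]//]; nia.
  by move: i_in; rewrite inE mem_index_iota => /orP[->|/andP[_ ->]]; rewrite ?orbT.
move=> d; apply: diag_ideal_eval_s; apply: diag_ideal_ext; last first.
  (* With E the Euler operator, s - [root_y i] = k (theta_y + i) + l E, and s - [root_y (q * n.+1)]
     = k' theta_x + l' E; comparing the coefficients of theta_x and theta_y gives the four
     scalars. *)
  apply: (diag_ideal_prod I w (fun a b => d.[weight w a b])
    (fun a b => a / p%:R + b / q%:R + n.+1%:R) (fun a _ => a) (fun _ b => b)
    (w2 - p%:R / q%:R * w1) (p%:R * w1) (w1 - q%:R / p%:R * w2) (q%:R * w2) q.-1).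
  - exact: diag_op_eval.
  - exact: diag_op_euler.
  - exact: diag_op_x.
  - exact: diag_op_y.
  - exact: diag_ideal_euler.
  - exact: diag_ideal_hamilton_x.
move=> a b; rewrite hornerM prednK // big_map big_cons hornerM hornerXsubC.
rewrite horner_prod; congr (_ * (_ * _)).
  by rewrite /root_y /weight natrM; field; rewrite p0 q0.
apply: eq_bigr => i _; rewrite hornerXsubC /root_y /weight.
by field; rewrite p0 q0.
Qed.

Let root_x i := weight w (- i%:R) (- (q%:R * (n.+1%:R - i%:R / p%:R))).

Lemma is_bfunction_x (B : {poly C}) : p%:R * w.1 < q%:R * w.2 ->
  B = \prod_(z <- [seq root_x i | i <- p * n.+1 :: index_iota 1 p]%N)
        ('X - z%:P) ->
  is_bfunction I w B /\ separable_poly B.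
Proof.
move=> lt_w ->; have d_lt0 : p%:R * w.1 - q%:R * w.2 < 0 by rewrite subr_lt0.
have d0 := delta_neq0 (ltr0_neq0 d_lt0).
apply: is_bfunction_roots.
- rewrite map_inj_uniq => [|i j].
    by rewrite /= iota_uniq mem_index_iota andbT; apply/negP; nia.
  rewrite /root_x /weight => e; apply/eqP; rewrite -(eqr_nat C) -subr_eq0.
  have : (j%:R - i%:R) * (p%:R * w1 - q%:R * w2) = 0 :> C.
    by apply: (mulIf (invr_neq0 p0)); rewrite mul0r -[RHS](subrr (root_x j))
      /root_x /weight -{1}e; field.
  by move/eqP; rewrite mulf_eq0 (negPf d0) orbF -opprB oppr_eq0.
- move=> c z /mapP[i i_in ->]; apply: fermat_root_x => //.
    by move: i_in; rewrite inE mem_index_iota => /orP[/eqP ->|/andP[]//]; nia.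
  by move: i_in; rewrite inE mem_index_iota => /orP[->|/andP[_ ->]]; rewrite ?orbT.
move=> d; apply: diag_ideal_eval_s; apply: diag_ideal_ext; last first.
  (* The same decompositions with x and y, p and q, w1 and w2 exchanged. *)
  apply: (diag_ideal_prod I w (fun a b => d.[weight w a b])
    (fun a b => a / p%:R + b / q%:R + n.+1%:R) (fun _ b => b) (fun a _ => a)
    (w1 - q%:R / p%:R * w2) (q%:R * w2) (w2 - p%:R / q%:R * w1) (p%:R * w1) p.-1).
  - exact: diag_op_eval.
  - exact: diag_op_euler.
  - exact: diag_op_y.
  - exact: diag_op_x.
  - exact: diag_ideal_euler.
  - exact: diag_ideal_hamilton_y.
move=> a b; rewrite hornerM prednK // big_map big_cons hornerM hornerXsubC.
rewrite horner_prod; congr (_ * (_ * _)).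
  by rewrite /root_x /weight natrM; field; rewrite p0 q0.
apply: eq_bigr => i _; rewrite hornerXsubC /root_x /weight.
by field; rewrite p0 q0.
Qed.

Lemma is_bfunction_homogeneous (B : {poly C}) : p%:R * w.1 = q%:R * w.2 ->
  B = \prod_(z <- [:: weight w 0 (- (q%:R * n.+1%:R))]) ('X - z%:P) ->
  is_bfunction I w B /\ separable_poly B.
Proof.
move=> eq_w ->; apply: is_bfunction_roots => [//|c z|d].
  by rewrite inE => /eqP ->; apply: fermat_root_homogeneous; rewrite // eq_w subrr.
have w12 : w1 = q%:R * w2 / p%:R.
  have e : p%:R * w1 = q%:R * w2.
    have := congr1 (real_complex R) eq_w.
    by rewrite !(rmorphM, rmorph_nat).
  by rewrite -e; field.
(* Here s minus the root is q w2 times the Euler operator. *)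
apply: diag_ideal_eval_s; apply: (diag_ideal_ext _ _ (fun a b =>
   (d.[weight w a b] * (q%:R * w2)) * (a / p%:R + b / q%:R + n.+1%:R))).
  move=> a b; rewrite hornerM big_seq1 hornerXsubC -mulrA; congr (_ * _).
  by rewrite /weight w12; field; rewrite p0 q0.
apply: diag_ideal_mul; last exact: diag_ideal_euler.
by apply: diag_op_mul; [apply: diag_op_eval | apply: diag_op_const].
Qed.

End BFunction.

Theorem mainTheorem17 (R : realType) (p q : nat) (l : int) (w : R * R) :
  (0 < p)%N -> (p <= q)%N -> l < 0 -> w != (0, 0) ->
  let C := R[i] in
  let f : {mpoly C[2]} := 'X_vx2 ^+ p + 'X_vy2 ^+ q in
  let w1 : C := real_complex R w.1 in
  let w2 : C := real_complex R w.2 in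
  let lC : C := l%:~R in
  let pC : C := p%:R in
  let qC : C := q%:R in
  let b : {poly C} :=
    if q%:R * w.2 < p%:R * w.1 then
      ('X - (lC * qC * w2)%:P) *
      \prod_(1 <= i < q) ('X - ((lC * pC + pC / qC * i%:R) * w1 - i%:R * w2)%:P)
    else if p%:R * w.1 < q%:R * w.2 then
      ('X - (lC * pC * w1)%:P) *
      \prod_(1 <= i < p) ('X - ((lC * qC + qC / pC * i%:R) * w2 - i%:R * w1)%:P)
    else 'X - (lC * pC * w1)%:P in
  is_bfunction (Ann f l) w b /\ separable_poly b.
Proof.
move=> p_gt0 le_pq l_lt0 _; have q_gt0 := leq_trans p_gt0 le_pq.
(* [Negz n] is -(n+1), so f^l is 1 / f^(n+1). *)
case: l l_lt0 => // n _ C f w1 w2 lC pC qC b.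
have p0 : pC != 0 by rewrite pnatr_eq0 -lt0n.
have q0 : qC != 0 by rewrite pnatr_eq0 -lt0n.
have lE : lC = - n.+1%:R by rewrite /lC NegzE mulrNz.
rewrite /b; case: ltgtP => [lt_w | lt_w | eq_w].
- apply: (is_bfunction_y p q n w) => //.
  rewrite big_map big_cons; congr (_ * _).
    congr ('X - _%:P); rewrite /weight lE natrM -/pC -/qC -/w1 -/w2.
    by field.
  apply: eq_bigr => i _; congr ('X - _%:P).
  by rewrite /weight lE -/pC -/qC -/w1 -/w2; field.
- apply: (is_bfunction_x p q n w) => //.
  rewrite big_map big_cons; congr (_ * _).
    congr ('X - _%:P); rewrite /weight lE natrM -/pC -/qC -/w1 -/w2.
    by field.
  apply: eq_bigr => i _; congr ('X - _%:P).
  by rewrite /weight lE -/pC -/qC -/w1 -/w2; field.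
- apply: (is_bfunction_homogeneous p q n w) => //.
  rewrite big_seq1; congr ('X - _%:P); rewrite /weight lE.
  have e : pC * w1 = qC * w2.
    have := congr1 (real_complex R) eq_w.
    by rewrite !(rmorphM, rmorph_nat).
  by rewrite -mulrA e -/w1 -/w2 -/qC; ring.
Qed.
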